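(* Consider the two-lane macroscopic traffic model $$\partial_t\rho_1+\partial_x f_1(\rho_1)=S(\rho_1,\rho_2),\qquad \partial_t\rho_2+\partial_x f_2(\rho_2)=-S(\rho_1,\rho_2),$$ $$S(\rho_1,\rho_2)=\pi^{2\to1}(\rho_2,\rho_1)A(\rho_2,\rho_1)\rho_1-\pi^{1\to2}(\rho_1,\rho_2)A(\rho_1,\rho_2)\rho_2,$$ with all functions, the equilibrium types (A), (B2), (C), (D), (E), and the stability notions as defined in the context. Let $(\overline\rho_1,\overline\rho_2)$ be a steady state of this model, and consider space-homogeneous, mass-conserving perturbations $$\rho_1=\overline\rho_1+\varepsilon\rho(t),\qquad \rho_2=\overline\rho_2-\varepsilon\rho(t),\qquad \rho(0)=\rho_0>0,$$ with $\varepsilon\neq0$ admissible. Then: (i) if $(\overline\rho_1,\overline\rho_2)$ is of type (A) or of type (E), it is globally asymptotically stable; (ii) if $(\overline\rho_1,\overline\rho_2)$ is of type (B2), or of type (C) with $\overline\rho_1=\mu$, it is asymptotically stable if $\varepsilon<0$, and marginally stable otherwise; (iii) if $(\overline\rho_1,\overline\rho_2)$ is of type (C) with $\overline\rho_2=\mu$, or of type (D) with $\overline\rho_2=\mu$, it is asymptotically stable if $\varepsilon>0$, and marginally stable otherwise; (iv) if $(\overline\rho_1,\overline\rho_2)$ is of type (C) with $\overline\rho_1>\mu$ and $\overline\rho_2>\mu$, or of type (D) with $\overline\rho_2>\mu$, it is marginally stable.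
   Context: **Model.** $\rho_j=\rho_j(x,t)$ is the (dimensionless) density in lane $j\in\{1,2\}$ on a ring road $x\in[0,L]$ with periodic boundary conditions, $t\ge0$. The maximal density is $\rho^{\max}=1$ and the critical density is $\mu=\tfrac12$. The flux is $f_j(\rho)=\rho\,v_j(\rho)$. The speed functions $v_1,v_2$ on $[0,\rho^{\max}]$ are (strictly) monotonically decreasing and satisfy $v_1(\rho)<v_2(\rho)$ for $\rho\in[0,\rho^{\max})$, $v_1(\rho^{\max})=v_2(\rho^{\max})=0$, and $v_j(0)=v_j^{\max}$. Write $v_j^\mu=v_j(\mu)$. The lane-change frequency is normalized to $\nu=1$. For $(h,k)\in\{(1,2),(2,1)\}$ set $$\pi^{h\to k}(\rho_h,\rho_k)=g(\rho_k)\,\mathbf 1_{lc}(\rho_h,\rho_k),\qquad g(\rho)=1-2\frac{\rho}{\rho^{\max}},$$ $$\mathbf 1_{lc}(\rho_h,\rho_k)=\max\{0,\min\{\operatorname{sign}(v_k(\rho_k)-v_h(\rho_h)),\ \operatorname{sign}(\mu-\rho_k)\}\},$$ $$A(\rho_h,\rho_k)=\frac{1}{\lambda(\rho_h)+(1-2\lambda(\rho_h))\rho_k}-1,\qquad \lambda(\rho)=1-\frac{\rho}{\rho^{\max}}.$$ Thus $\mathbf 1_{lc}(\rho_h,\rho_k)=1$ exactly when $v_k(\rho_k)>v_h(\rho_h)$ (incentive criterion) and $\rho_k<\mu$ (safety criterion), and it is $0$ otherwise. Densities are nonnegative and no lane change takes place out of an empty lane (so the term with $\pi^{h\to k}$ is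 absent when $\rho_h=0$). **Steady states.** A steady state (equilibrium) is a pair of constants $(\overline\rho_1,\overline\rho_2)$, with values in $(0,\rho^{\max}]$ (or with value $0$ where the types below allow it), for which no lane changes occur, i.e. the source terms vanish. The types are: - (A): $v_1(\overline\rho_1)=v_2(\overline\rho_2)$, $0\le\overline\rho_1<\mu$ and $0\le\overline\rho_2<\mu$. - (B2): $v^{\mathrm{eq}}:=v_1(\overline\rho_1)=v_2(\overline\rho_2)$, with $\overline\rho_1\ge\mu$ or $\overline\rho_2\ge\mu$, and $v_1^\mu<v^{\mathrm{eq}}\le v_2^\mu$ (so $\overline\rho_1<\mu\le\overline\rho_2$). - (C): $\overline\rho_1\ge\mu$ and $\overline\rho_2\ge\mu$, where the lane speeds $v_1(\overline\rho_1)$, $v_2(\overline\rho_2)$ may be different or equal (the equal-speed states with $0\le v^{\mathrm{eq}}\le v_1^\mu$, called (B1), are included in class (C)). - (D): $v_1(\overline\rho_1)<v_2(\overline\rho_2)$, $\overline\rho_1<\mu$ and $\overline\rho_2\ge\mu$. - (E): $\overline\rho_1=0$ and $\overline\rho_2\le v_2^{-1}(v_1^{\max})$. **Perturbations and stability.** A nonzero $\varepsilon\in\mathbb R$ (together with $\rho_0>0$) is admissible if the initial perturbed densities $\overline\rho_1+\varepsilon\rho_0$ and $\overline\rho_2-\varepsilon\rho_0$ lie in $(0,\rho^{\max}]$. In particular, for type (E) only $\varepsilon>0$ is admissible. Since perturbations are homogeneous in space, the perturbed solution $(\rho_1(t),\rho_2(t))$ of the model depends only on $t$ and conserves $\rho_1+\rho_2$.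 With respect to these perturbations the equilibrium $(\overline\rho_1,\overline\rho_2)$ is called: - *asymptotically stable* if there exists $\varepsilon$ such that $(\rho_1,\rho_2)\to(\overline\rho_1,\overline\rho_2)$ as $t\to\infty$; the phrase ''asymptotically stable if $\varepsilon<0$'' (resp. $\varepsilon>0$) means that this convergence holds for the perturbations with $\varepsilon<0$ (resp. $\varepsilon>0$); - *globally asymptotically stable* if for all (admissible) $\varepsilon\in\mathbb R$ one has $(\rho_1,\rho_2)\to(\overline\rho_1,\overline\rho_2)$ as $t\to\infty$; - *marginally stable* if for a given $\varepsilon$ one has $(\rho_1,\rho_2)\to(\tilde\rho_1,\tilde\rho_2)$ as $t\to\infty$, where $(\tilde\rho_1,\tilde\rho_2)$ is an equilibrium different from $(\overline\rho_1,\overline\rho_2)$; the phrase ''marginally stable otherwise'' means that this holds for the perturbations with $\varepsilon$ of the other sign, and ''marginally stable'' without qualification means that it holds for the given nonzero admissible $\varepsilon$ under consideration.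
   Formalization: The speeds are also assumed continuous; in (i), type (E) needs ρ̄2 ≤ μ; in (ii), the ε<0 claim for (C) with ρ̄1=μ needs v2(ρ̄2) ≤ v1(ρ̄1), and the ε>0 claim needs ρ̄2 ≠ μ. The claims fail without these conditions. *)

(* Defs.v *)
From HB Require Import structures.
From mathcomp Require Import all_boot all_order all_algebra.
From mathcomp Require Import all_classical all_reals all_analysis.

Set Implicit Arguments.
Unset Strict Implicit.
Unset Printing Implicit Defensive.

Import Order.TTheory GRing.Theory Num.Theory.
Import numFieldNormedType.Exports.

Local Open Scope classical_set_scope.
Local Open Scope ring_scope.

Section TwoLaneModel.
Context {R : realType}.

Definition rhomax : R := 1.
Definition mu : R := 2^-1.

(* Continuity on [0, rhomax] is what makes v_2^{-1} and the intermediate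
   values of the speeds meaningful. *)
Definition speed_functions (v1 v2 : R -> R) : Prop :=
  [/\ {within `[0, rhomax], continuous v1},
      {within `[0, rhomax], continuous v2},
      {in `[0, rhomax] &, {homo v1 : x y /~ x < y}},
      {in `[0, rhomax] &, {homo v2 : x y /~ x < y}} &
      {in `[0, rhomax[, forall x, v1 x < v2 x} /\
      (v1 rhomax = 0 /\ v2 rhomax = 0)].

Definition flux (v : R -> R) (x : R) : R := x * v x.

Definition lambda (x : R) : R := 1 - x / rhomax.

Definition g (x : R) : R := 1 - 2 * (x / rhomax).

Definition ind_lc (vh vk : R -> R) (rh rk : R) : R :=
  Num.max 0 (Num.min (Num.sg (vk rk - vh rh)) (Num.sg (mu - rk))).

Definition lane_change_prob (vh vk : R -> R) (rh rk : R) : R :=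
  g rk * ind_lc vh vk rh rk.

Definition Acoef (rh rk : R) : R :=
  (lambda rh + (1 - 2 * lambda rh) * rk)^-1 - 1.

(* Rate of lane changes h -> k.  The case rh = 0 must be set apart: the
   product alone need not vanish there, as Acoef 0 rk = rk / (1 - rk). *)
Definition lane_change_rate (vh vk : R -> R) (rh rk : R) : R :=
  if rh == 0 then 0 else lane_change_prob vh vk rh rk * Acoef rh rk * rk.

Definition source (v1 v2 : R -> R) (r1 r2 : R) : R :=
  lane_change_rate v2 v1 r2 r1 - lane_change_rate v1 v2 r1 r2.

(* [u x t] solves u_t + f(u)_x = s for t >= 0, in integral form on all the
   rectangles [a, b] x [0, t].  Classical solutions do not suffice: the source
   jumps at v1 = v2, where solutions are typically only Lipschitz in time.
   The integrability clauses are needed because [Rintegral] is total. *)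
Definition balance_law (f : R -> R) (u s : R -> R -> R) : Prop :=
  forall a b t : R, a <= b -> 0 <= t ->
  let leb := @lebesgue_measure R in
  [/\ forall tau, 0 <= tau ->
        leb.-integrable `[a, b] (fun x => (u x tau)%:E) /\
        leb.-integrable `[a, b] (fun x => (s x tau)%:E),
      leb.-integrable `[0, t] (fun tau => (f (u a tau))%:E),
      leb.-integrable `[0, t] (fun tau => (f (u b tau))%:E),
      leb.-integrable `[0, t]
        (fun tau => (\int[leb]_(x in `[a, b]) s x tau)%:E) &
      \int[leb]_(x in `[a, b]) u x t - \int[leb]_(x in `[a, b]) u x 0
      + (\int[leb]_(tau in `[0, t]) f (u b tau)
         - \int[leb]_(tau in `[0, t]) f (u a tau))
      = \int[leb]_(tau in `[0, t]) \int[leb]_(x in `[a, b]) s x tau].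

Definition ring_density (L : R) (u : R -> R -> R) : Prop :=
  forall x t, 0 <= t -> 0 <= u x t <= rhomax /\ u (x + L) t = u x t.

Definition two_lane_solution (v1 v2 : R -> R) (L : R)
    (rho1 rho2 : R -> R -> R) : Prop :=
  [/\ ring_density L rho1, ring_density L rho2,
      balance_law (flux v1) rho1
        (fun x t => source v1 v2 (rho1 x t) (rho2 x t)) &
      balance_law (flux v2) rho2
        (fun x t => - source v1 v2 (rho1 x t) (rho2 x t))].

Definition type_A (v1 v2 : R -> R) (r1 r2 : R) : Prop :=
  [/\ v1 r1 = v2 r2, 0 <= r1 < mu & 0 <= r2 < mu].

Definition type_B2 (v1 v2 : R -> R) (r1 r2 : R) : Prop :=
  [/\ v1 r1 = v2 r2, mu <= r1 \/ mu <= r2 & v1 mu < v1 r1 <= v2 mu].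

Definition type_C (r1 r2 : R) : Prop := mu <= r1 /\ mu <= r2.

Definition type_D (v1 v2 : R -> R) (r1 r2 : R) : Prop :=
  [/\ v1 r1 < v2 r2, r1 < mu & mu <= r2].

(* [r] is v_2^{-1}(v_1^max), with v_1^max = v_1(0). *)
Definition type_E (v1 v2 : R -> R) (r1 r2 : R) : Prop :=
  r1 = 0 /\ exists r, [/\ 0 <= r <= rhomax, v2 r = v1 0 & r2 <= r].

Definition steady_state (v1 v2 : R -> R) (r1 r2 : R) : Prop :=
  [/\ 0 <= r1 <= rhomax, 0 <= r2 <= rhomax,
      (0 < r1 /\ 0 < r2) \/
      [\/ type_A v1 v2 r1 r2, type_B2 v1 v2 r1 r2, type_D v1 v2 r1 r2
        | type_E v1 v2 r1 r2] &
      source v1 v2 r1 r2 = 0].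

Definition admissible (r1 r2 eps rho0 : R) : Prop :=
  [/\ eps != 0, 0 < rho0, 0 < r1 + eps * rho0 <= rhomax &
      0 < r2 - eps * rho0 <= rhomax].

Definition perturbed_solution (v1 v2 : R -> R) (L r1 r2 eps rho0 : R)
    (rho : R -> R) : Prop :=
  rho 0 = rho0 /\
  two_lane_solution v1 v2 L (fun _ t => r1 + eps * rho t)
                            (fun _ t => r2 - eps * rho t).

Definition perturbation_tends_to (r1 r2 eps : R) (rho : R -> R) (s1 s2 : R) :
    Prop :=
  (r1 + eps * rho t @[t --> +oo] --> s1) /\
  (r2 - eps * rho t @[t --> +oo] --> s2).

Definition returns (v1 v2 : R -> R) (L r1 r2 eps rho0 : R) : Prop :=
  forall rho, perturbed_solution v1 v2 L r1 r2 eps rho0 rho ->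
    perturbation_tends_to r1 r2 eps rho r1 r2.

Definition leaves (v1 v2 : R -> R) (L r1 r2 eps rho0 : R) : Prop :=
  forall rho, perturbed_solution v1 v2 L r1 r2 eps rho0 rho ->
    exists s1 s2, [/\ steady_state v1 v2 s1 s2, (s1, s2) <> (r1, r2) &
      perturbation_tends_to r1 r2 eps rho s1 s2].

Definition asymptotically_stable_if (P : R -> Prop)
    (v1 v2 : R -> R) (L r1 r2 : R) : Prop :=
  forall eps rho0, admissible r1 r2 eps rho0 -> P eps ->
    returns v1 v2 L r1 r2 eps rho0.

Definition globally_asymptotically_stable
    (v1 v2 : R -> R) (L r1 r2 : R) : Prop :=
  forall eps rho0, admissible r1 r2 eps rho0 ->
    returns v1 v2 L r1 r2 eps rho0.

Definition marginally_stable_if (P : R -> Prop)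
    (v1 v2 : R -> R) (L r1 r2 : R) : Prop :=
  forall eps rho0, admissible r1 r2 eps rho0 -> P eps ->
    leaves v1 v2 L r1 r2 eps rho0.

Definition marginally_stable (v1 v2 : R -> R) (L r1 r2 : R) : Prop :=
  forall eps rho0, admissible r1 r2 eps rho0 ->
    leaves v1 v2 L r1 r2 eps rho0.

End TwoLaneModel.

(* Main.v *)
Require Import Defs.
From HB Require Import structures.
From mathcomp Require Import all_boot all_order all_algebra.
From mathcomp Require Import all_classical all_reals all_analysis.
From mathcomp Require Import lra.

Set Implicit Arguments.
Unset Strict Implicit.
Unset Printing Implicit Defensive.

Import Order.TTheory GRing.Theory Num.Theory.
Import numFieldNormedType.Exports.

Local Open Scope classical_set_scope.
Local Open Scope ring_scope.

(** A spatially homogeneous perturbation makes the fluxes cancel and leaves a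
scalar equation [y' = S(y, M - y)] for [y = rho_1], where [M = r1 + r2] is
conserved, read in integral form because [S] jumps where the speeds agree.

The sign of [S] decides everything.  With [d(y) = v1 y - v2 (M - y)], which is
strictly decreasing, lane 1 can gain density only if [d(y) > 0] and [y < mu],
and lane 2 can gain density only if [d(y) < 0] and [M - y < mu].  Hence a
solution that starts to fill one lane keeps filling it up to the first obstacle:
the speeds balance, the lane reaches the critical density, or the other lane
runs empty.  It cannot cross that obstacle, where the source is zero or points
back, and it cannot stop before it, because the rate into a lane of density [y]
is at least [(1 - 2 y) y ^ 2] ([lane_change_rate_ge], [fills_up_to]).  The first
obstacle exists by the intermediate value theorem ([fill_target]).  Exchanging
the lanes ([flow_sym]) treats both directions alike, so every admissible
perturbation converges to a steady state ([flow_settles]).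

What remains is to locate the limit.  If the unperturbed state is itself the
first obstacle met from the perturbed side, the solution returns to it
([returns_filling1], [returns_filling2]).  In the marginal cases the limit is
another state ([leaves_if]): a lane is never filled beyond [mu], which excludes
a return to a denser lane, and a speed gap at the unperturbed state makes the
speeds balance strictly on one side of it. *)

(** * Bounds on the lane-change rates *)

Section Rates.
Context {R : realType}.
Implicit Types (vh vk : R -> R) (rh rk x w : R).

Lemma lane_change_rate0 vh vk rh rk :
  [\/ vk rk <= vh rh, mu <= rk, rh = 0 | rk = 0] ->
  lane_change_rate vh vk rh rk = 0.
Proof.
rewrite /lane_change_rate /lane_change_prob.
case: eqVneq => // rh0 rk_blocked.
suff [->|->] : rk = 0 \/ ind_lc vh vk rh rk = 0.
- by rewrite mulr0.
- by rewrite mulr0 !mul0r.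
case: rk_blocked => [slower|full|/eqP|]; last by left.
- right; apply/max_idPl; rewrite ge_min; apply/orP; left.
  by rewrite sgr_le0 subr_le0.
- right; apply/max_idPl; rewrite ge_min; apply/orP; right.
  by rewrite sgr_le0 subr_le0.
- by rewrite (negbTE rh0).
Qed.

(** The denominator of [Acoef] is the convex combination
[(1 - rh) (1 - rk) + rh rk] of [1 - rk] and [rk], so for [0 < rk < mu] it is
positive and at most [1 - rk]; hence [Acoef >= rk] however full lane [h] is.
Being uniform in [rh] and explicit in [rk], the bound makes any continuity
argument for the discontinuous source superfluous. *)
Lemma lane_change_rate_ge vh vk rh rk :
  0 < rh <= 1 -> 0 <= rk < mu -> vh rh < vk rk ->
  (1 - 2 * rk) * rk ^+ 2 <= lane_change_rate vh vk rh rk.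
Proof.
rewrite /mu => /andP[rh0 rh1] /andP[]; rewrite le_eqVlt => /predU1P[<- _ _|].
  by rewrite lane_change_rate0 ?expr0n ?mulr0//; apply: Or44.
move=> rk0 rk_mu faster.
rewrite /lane_change_rate gt_eqF// /lane_change_prob /ind_lc.
rewrite !gtr0_sg ?subr_gt0// minxx (max_idPr _)// mulr1 -mulrA expr2.
rewrite /g /rhomax divr1 ler_wpM2l//; first by lra.
rewrite ler_wpM2r ?(ltW rk0)// /Acoef /lambda /rhomax divr1.
set D := (X in X^-1).
have D0 : 0 < D by rewrite /D; nra.
have D1 : D <= 1 - rk by rewrite /D; nra.
rewrite lerBrDr -(ler_pM2r D0) mulVf ?gt_eqF//.
by nra.
Qed.

Lemma lane_change_rate_ge0 vh vk rh rk : 0 <= rh <= 1 -> 0 <= rk ->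
  0 <= lane_change_rate vh vk rh rk.
Proof.
move=> /andP[rh0 rh1] rk0.
have [slower|faster] := leP (vk rk) (vh rh).
  by rewrite lane_change_rate0//; apply: Or41.
have [full|safe] := leP mu rk.
  by rewrite lane_change_rate0//; apply: Or42.
have [<-|rh_neq0] := eqVneq 0 rh.
  by rewrite lane_change_rate0//; apply: Or43.
have rh_gt0 : 0 < rh by rewrite lt_neqAle rh_neq0.
apply: le_trans (lane_change_rate_ge _ _ faster); rewrite ?rh_gt0 ?rk0//.
by rewrite mulr_ge0 ?sqr_ge0//; move: safe; rewrite /mu; lra.
Qed.

Lemma sourceN (v1 v2 : R -> R) x w : source v2 v1 w x = - source v1 v2 x w.
Proof. by rewrite /source opprB. Qed.

Lemma source_ge0 (v1 v2 : R -> R) x w : 0 <= x -> 0 <= w <= 1 -> v2 w <= v1 x ->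
  0 <= source v1 v2 x w.
Proof.
move=> x0 w01 slower; rewrite /source (@lane_change_rate0 v1); last exact: Or41.
by rewrite subr0 lane_change_rate_ge0.
Qed.

Lemma source_le0 (v1 v2 : R -> R) x w : 0 <= x <= 1 -> 0 <= w ->
  [\/ v1 x <= v2 w, mu <= x | w = 0] -> source v1 v2 x w <= 0.
Proof.
move=> x01 w0 blocked; rewrite /source (@lane_change_rate0 v2).
  by rewrite sub0r oppr_le0 lane_change_rate_ge0.
by case: blocked => ?; [apply: Or41 | apply: Or42 | apply: Or43].
Qed.

Lemma source_ge (v1 v2 : R -> R) x w :
  0 <= x < mu -> 0 < w <= 1 -> v2 w < v1 x ->
  (1 - 2 * x) * x ^+ 2 <= source v1 v2 x w.
Proof.
move=> x_mu w01 faster; rewrite /source (@lane_change_rate0 v1).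
  by rewrite subr0 lane_change_rate_ge.
by apply: Or41; exact: ltW.
Qed.

End Rates.

(** * Solutions of the homogeneous balance law *)

Section Flow.
Context {R : realType}.
Implicit Types (y z u : R -> R) (s w : R).
Notation leb := (@lebesgue_measure R).

(** What a pair of balance laws says about densities that do not depend on
space; unlike the balance laws it is visibly symmetric in the lanes. *)
Definition homogeneous_flow (v1 v2 : R -> R) y z := forall t, 0 <= t ->
  [/\ 0 <= y t <= 1, 0 <= z t <= 1, y t + z t = y 0 + z 0,
      leb.-integrable `[0, t]
        (EFin \o (fun tau => source v1 v2 (y tau) (z tau))) &
      y t = y 0 + \int[leb]_(tau in `[0, t]) source v1 v2 (y tau) (z tau)].

(** The left end is excluded from the bound on the rate so that [a] can be the
last time before a threshold is exceeded, where the rate may have either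
sign. *)
Lemma le_increment (f u : R -> R) (a b c : R) : 0 <= a <= b ->
  leb.-integrable `[0, b] (EFin \o f) ->
  (forall t, 0 <= t -> u t = u 0 + \int[leb]_(tau in `[0, t]) f tau) ->
  (forall t, a < t <= b -> c <= f t) -> c * (b - a) <= u b - u a.
Proof.
move=> /andP[a0 ab] intf uE f_ge; rewrite (uE b) ?(uE a) ?(le_trans a0)//.
rewrite opprD addrACA subrr add0r Rintegral_itvB//.
have sub : `]a, b] `<=` `[0, b].
  by apply: subset_itvr; rewrite bnd_simp.
rewrite -[leLHS]/(c * (b - a)).
have <- : \int[leb]_(tau in `]a, b]) (cst c) tau = c * (b - a).
  rewrite Rintegral_cst//= lebesgue_measure_itv/= lte_fin.
  by case: ltP => [|ba] //=; rewrite (_ : b = a) ?subrr//; apply/le_anti/andP.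
apply: le_Rintegral => //.
- apply: (@integrableS _ _ _ leb `[a, b]%classic) => //.
    exact: subset_itv_oc_cc.
  apply: continuous_compact_integrable; first exact: segment_compact.
  by apply: continuous_subspaceT => x; exact: cvg_cst.
- exact: integrableS intf.
Qed.

(** If [u] exceeded [s] at time [b], it would have to increase after the last
time [sup E] at which it was at most [s]; continuity puts [sup E] in [E]. *)
Lemma barrier u s (b : R) :
  0 <= b -> {within `[0, b], continuous u} -> u 0 <= s ->
  (forall a, 0 <= a <= b -> (forall t, a < t <= b -> s < u t) -> u b <= u a) ->
  u b <= s.
Proof.
move=> b0 cu u0 no_escape.
pose E := `[0, b]%classic `&` [set t | u t <= s].
have E0 : E 0 by split => //=; rewrite in_itv/= lexx.
have ubE : ubound E b by move=> t [] /=; rewrite in_itv/= => /andP[].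
have supE : E (sup E).
  suff cE : closed E.
    by apply: cE; apply: closure_sup; [exists 0 | exists b].
  have /continuous_closedP /(_ _ (@closed_le R s)) := cu.
  move=> /closed_subspaceP[V cV VE].
  rewrite /E setIC.
  have -> : [set t | u t <= s] `&` `[0, b] = V `&` `[0, b] by rewrite VE.
  by apply: closedI => //; exact: itv_closed.
have [/=] := supE; rewrite in_itv/= => supE0b us.
apply: le_trans us; apply: no_escape => // t /andP[supE_t tb].
rewrite ltNge; apply/negP => uts.
have : E t.
  split => //=; rewrite in_itv/= tb andbT.
  by move: supE0b => /andP[/le_trans-> //]; exact: ltW.
move=> Et; have := ub_le_sup (ex_intro _ b ubE) Et.
by rewrite leNgt supE_t.
Qed.

Lemma antitone_le (v : R -> R) (x x' : R) :
  {in `[0, rhomax] &, {homo v : a b /~ a < b}} ->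
  0 <= x <= x' -> x' <= 1 -> v x' <= v x.
Proof.
move=> dec_v /andP[x0]; rewrite le_eqVlt => /predU1P[<-//|xx'] x'1.
apply/ltW/dec_v => //; rewrite in_itv/= /rhomax.
  by rewrite x'1 (le_trans x0)// ltW.
by rewrite x0 (le_trans _ x'1)// ltW.
Qed.

Lemma flow_continuous (v1 v2 : R -> R) y z b : homogeneous_flow v1 v2 y z ->
  0 <= b -> {within `[0, b], continuous y}.
Proof.
move=> flow b0; have [_ _ _ intS _] := flow b b0.
have cS := parameterized_integral_continuous b0 intS.
apply: (@subspace_eq_continuous _ _ _ (fun t => y 0 +
    parameterized_integral leb 0 t (fun tau => source v1 v2 (y tau) (z tau)))).
  move=> t; rewrite inE/= in_itv/= => /andP[t0 _].
  by have [_ _ _ _ <-] := flow t t0.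
by move=> t; apply: cvgD; [exact: cvg_cst | exact: cS].
Qed.

Lemma flow_sym (v1 v2 : R -> R) y z :
  homogeneous_flow v1 v2 y z -> homogeneous_flow v2 v1 z y.
Proof.
move=> flow t t0; have [y01 z01 yzE intS yE] := flow t t0.
have oppE : (fun tau => source v2 v1 (z tau) (y tau)) =
    (fun tau => -1 * source v1 v2 (y tau) (z tau)).
  by apply/funext => tau; rewrite mulN1r sourceN.
split => //; first by rewrite addrC yzE addrC.
- have -> : EFin \o (fun tau => source v2 v1 (z tau) (y tau)) =
      (fun tau => (-1)%:E *
        (EFin \o (fun tau => source v1 v2 (y tau) (z tau))) tau)%E.
    by rewrite oppE; apply/funext => tau; rewrite /= EFinM.
  exact: integrableZl.
- by rewrite oppE RintegralZl// mulN1r; lra.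
Qed.

(** At the target [(s, w)] lane 1 is still at least as fast, so below [s] it is
strictly faster and nothing leaves it; and something blocks lane 1 there, so
nothing enters it above [s].  Thus [y] increases and stays below [s].  If [y]
stayed below [s - e], its rate would be at least [2 e (y 0) ^ 2] forever, which
is impossible for a bounded function.  The alternative [y 0 = s] covers flows
that are at rest with lane 1 above the critical density. *)
Lemma fills_up_to (v1 v2 : R -> R) y z s w :
  {in `[0, rhomax] &, {homo v1 : a b /~ a < b}} ->
  {in `[0, rhomax] &, {homo v2 : a b /~ a < b}} ->
  homogeneous_flow v1 v2 y z ->
  0 < y 0 -> y 0 <= s <= 1 -> 0 <= w -> s + w = y 0 + z 0 ->
  v2 w <= v1 s -> [\/ v1 s <= v2 w, mu <= s | w = 0] ->
  (y 0 = s \/ s <= mu) ->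
  (y t @[t --> +oo] --> s) /\ (z t @[t --> +oo] --> w).
Proof.
move=> dec1 dec2 flow y0_gt0 /andP[y0s s1] w0 swE attracts blocks range.
have s0 : 0 < s by exact: lt_le_trans y0s.
have w1 : w <= 1.
  by have [_ /andP[_ z1] _ _ _] := flow 0 (lexx 0); move: z1 swE y0s; lra.
have zE t : 0 <= t -> z t = s + w - y t.
  move=> t0; have [_ _ /esym + _ _] := flow t t0; rewrite swE => ->.
  by rewrite addrC addKr.
have yE t : 0 <= t -> y t = y 0 +
    \int[leb]_(tau in `[0, t]) source v1 v2 (y tau) (z tau).
  by move=> t0; have [] := flow t t0.
have y_le_s t : 0 <= t -> y t <= s.
  move=> t0; apply: (barrier t0 (flow_continuous flow t0)) => //.
  move=> a /andP[a0 a_t] above.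
  have [_ _ _ intS' _] := flow_sym flow t0.
  have z'E tau : 0 <= tau -> z tau = z 0 +
      \int[leb]_(tau' in `[0, tau]) source v2 v1 (z tau') (y tau').
    by move=> tau0; have [] := flow_sym flow tau0.
  suff : 0 * (t - a) <= z t - z a by rewrite mul0r !zE//; lra.
  apply: le_increment intS' z'E _; rewrite ?a0// => tau /andP[a_tau tau_t].
  have tau0 : 0 <= tau by rewrite (le_trans a0)// ltW.
  have [/andP[y_0 y_1] /andP[z_0 _] _ _ _] := flow tau tau0.
  have s_y : s < y tau by apply: above; rewrite a_tau.
  rewrite sourceN oppr_ge0; apply: source_le0; rewrite ?y_0//.
  have zw : z tau <= w by rewrite zE//; lra.
  case: blocks => [slower|full|w_empty].
  - apply: Or31; apply: le_trans (le_trans slower _).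
      by apply: antitone_le dec1 _ _; rewrite ?y_1 ?(ltW s0) ?(ltW s_y).
    by apply: antitone_le dec2 _ _; rewrite ?z_0.
  - by apply: Or32; rewrite (le_trans full)// ltW.
  - by apply: Or33; apply/eqP; rewrite eq_le z_0 -{1}w_empty zw.
(* since y <= s, lane 1 is at least as fast along the whole trajectory *)
have source_y_ge0 t : 0 <= t -> 0 <= source v1 v2 (y t) (z t).
  move=> t0; have [/andP[y0 y1] /andP[z0 z1] _ _ _] := flow t t0.
  have wz : w <= z t by rewrite zE//; have := y_le_s t t0; lra.
  apply: source_ge0 => //; first by rewrite z0.
  apply: le_trans (le_trans _ attracts) _.
    by apply: antitone_le dec2 _ _ => //; rewrite w0.
  by apply: antitone_le dec1 _ _ => //; rewrite y0 y_le_s.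
have y_incr a b : 0 <= a <= b -> y a <= y b.
  move=> ab; have b0 : 0 <= b by case/andP: ab => /le_trans; apply.
  have [_ _ _ intS _] := flow b b0.
  have := le_increment (c := 0) ab intS yE; rewrite mul0r subr_ge0; apply => t.
  move=> /andP[a_t _]; apply/source_y_ge0/ltW; apply: le_lt_trans a_t.
  by case/andP: ab.
suff cvg_y : y t @[t --> +oo] --> s.
  split => //; rewrite (_ : w = s + w - s); last by rewrite addrC addKr.
  apply: cvg_trans (cvgB (cvg_cst (s + w)) cvg_y).
  apply: near_eq_cvg; near=> t; rewrite /= zE//.
apply/cvgrPdist_le => e e0.
(* the least rate while y 0 <= y <= s - e, as s <= mu *)
pose c := 2 * e * y 0 ^+ 2.
have c0 : 0 < c by rewrite !mulr_gt0.
near=> t.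
have t0 : 0 <= t by near: t; exact: nbhs_pinfty_ge.
have tc : c^-1 < t by near: t; apply: nbhs_pinfty_gt; exact: num_real.
rewrite ger0_norm ?subr_ge0 ?y_le_s// lerBlDr -lerBlDl leNgt.
apply/negP => below.
have y0_t : y 0 <= y t by apply: y_incr; rewrite lexx.
have s_mu : s <= mu.
  case: range => // y0E; exfalso; move: y0_t below; rewrite y0E; lra.
have [_ _ _ intS _] := flow t t0.
have : c * (t - 0) <= y t - y 0.
  apply: le_increment intS yE _; rewrite ?lexx// => tau /andP[tau0 tau_t].
  have {}tau0 := ltW tau0.
  have y0_tau : y 0 <= y tau by apply: y_incr; rewrite lexx.
  have ytau_t : y tau <= y t by apply: y_incr; rewrite tau0.
  have [/andP[_ y1] /andP[_ z1] _ _ _] := flow tau tau0.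
  have ztau : w < z tau by rewrite zE//; lra.
  apply: le_trans (source_ge _ _ _); last 3 first.
  - by move: s_mu; rewrite /mu; lra.
  - by rewrite z1 andbT; exact: le_lt_trans ztau.
  - apply: lt_le_trans (le_trans attracts _).
      apply: dec2 => //; rewrite in_itv/= /rhomax ?w0 ?w1 ?z1 ?andbT//.
      by rewrite (le_trans w0)// ltW.
    apply: antitone_le dec1 _ _ => //; lra.
  have gap : 2 * e <= 1 - 2 * y tau by move: s_mu; rewrite /mu; lra.
  have sqr_le : y 0 ^+ 2 <= y tau ^+ 2.
    by rewrite ler_sqr ?nnegrE//; lra.
  by apply: ler_pM => //; [lra | exact: sqr_ge0].
rewrite subr0; apply/negP; rewrite -ltNge.
have : 1 < c * t by rewrite mulrC -ltr_pdivrMr// mul1r.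
by lra.
Unshelve. all: by end_near.
Qed.

Lemma Rintegral_unit_cst (c : R) : \int[leb]_(x in `[0, 1]) c = c.
Proof.
rewrite -[X in Rintegral _ _ X]/(cst c) Rintegral_cst//=.
by rewrite lebesgue_measure_itv/= lte_fin ltr01 oppr0 addr0 mulr1.
Qed.

(** On the space interval [[0, 1]] the two boundary fluxes coincide and the space
integrals of constants are these constants. *)
Lemma perturbed_flow (v1 v2 : R -> R) (L r1 r2 eps rho0 : R) (rho : R -> R) :
  perturbed_solution v1 v2 L r1 r2 eps rho0 rho ->
  homogeneous_flow v1 v2
    (fun t => r1 + eps * rho t) (fun t => r2 - eps * rho t).
Proof.
move=> [_ [ring1 ring2 law1 _]] t t0.
have [y01 _] := ring1 0 t t0; have [z01 _] := ring2 0 t t0.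
have [_ _ _ + +] := law1 0 1 t ler01 t0.
have -> : (fun tau => \int[leb]_(x in `[0, 1])
      source v1 v2 (r1 + eps * rho tau) (r2 - eps * rho tau)) =
    (fun tau => source v1 v2 (r1 + eps * rho tau) (r2 - eps * rho tau)).
  by apply/funext => tau; rewrite Rintegral_unit_cst.
rewrite !Rintegral_unit_cst subrr addr0 => intS yE; split => //.
- by lra.
- rewrite (_ : EFin \o _ = fun tau => (\int[leb]_(x in `[0, 1])
      source v1 v2 (r1 + eps * rho tau) (r2 - eps * rho tau))%:E).
    exact: intS.
  by apply/funext => tau; rewrite Rintegral_unit_cst.
- by apply/eqP; rewrite [eqbRHS]addrC -subr_eq; apply/eqP; exact: yE.
Qed.

Lemma within_continuous_reflect (v : R -> R) (m a b : R) :
  {within `[0, 1], continuous v} -> 0 <= m - b -> m - a <= 1 ->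
  {within `[a, b], continuous (fun x => v (m - x))}.
Proof.
move=> /subspace_continuousP cv mb ma.
have reflect_in x : `[a, b]%classic x -> `[0, 1]%classic (m - x).
  by rewrite /= !in_itv/=; lra.
apply/subspace_continuousP => x xab P nbhsP.
have {}nbhsP := cv _ (reflect_in x xab) P nbhsP.
have cB : (fun t : R => m - t) @ x --> m - x.
  by apply: cvgB; [exact: cvg_cst | exact: cvg_id].
have {nbhsP cB} : \forall t \near x, `[0, 1]%classic (m - t) -> P (v (m - t)).
  exact: cB nbhsP.
change ((\forall t \near x, `[0, 1]%classic (m - t) -> P (v (m - t))) ->
  \forall t \near x, `[a, b]%classic t -> P (v (m - t))).
by apply: filterS => t P_t /reflect_in.
Qed.

(** The first obstacle on the way up: if lane 1 is not yet slower at
[m = min mu (y0 + z0)], where it is critical or lane 2 is empty, that is the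
obstacle; otherwise the speeds balance between [y0] and [m]. *)
Lemma fill_target (v1 v2 : R -> R) (y0 z0 : R) :
  {within `[0, rhomax], continuous v1} -> {within `[0, rhomax], continuous v2} ->
  0 <= y0 <= mu -> 0 <= z0 <= 1 -> v2 z0 <= v1 y0 ->
  exists s w, [/\ s + w = y0 + z0, y0 <= s <= mu, 0 <= w, v2 w <= v1 s &
    [\/ v1 s <= v2 w, mu <= s | w = 0]].
Proof.
rewrite /rhomax /mu => c1 c2 /andP[y00 y0_mu] /andP[z00 z01] faster.
pose m := Num.min 2^-1 (y0 + z0).
have y0m : y0 <= m by rewrite le_min y0_mu lerDl.
have m_mu : m <= 2^-1 by rewrite ge_min lexx.
have m_tot : m <= y0 + z0 by rewrite ge_min lexx orbT.
have [m_fast|m_slow] := leP (v2 (y0 + z0 - m)) (v1 m).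
  exists m, (y0 + z0 - m); split => //; first by lra.
  - by rewrite y0m.
  - by rewrite subr_ge0.
  - rewrite /m minEle; case: ifP => _; first exact: Or32.
    by apply: Or33; rewrite subrr.
pose d x := v1 x - v2 (y0 + z0 - x).
have cd : {within `[y0, m], continuous d}.
  apply: within_continuousB.
    apply: continuous_subspaceW c1 => x /=; rewrite !in_itv/=; lra.
  by apply: within_continuous_reflect => //; lra.
have d_y0 : 0 <= d y0 by rewrite /d subr_ge0 addrC addKr.
have d_m : d m <= 0 by rewrite /d subr_le0 ltW.
have [|s] := IVT y0m cd (v := 0).
  by rewrite ge_min le_max d_y0 d_m orbT.
rewrite in_itv/= => /andP[y0s sm] /eqP; rewrite subr_eq0 => /eqP sE.
exists s, (y0 + z0 - s); split; rewrite -?sE ?y0s//; [lra|lra|lra|].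
exact: Or31.
Qed.

Lemma flow_settles_up (v1 v2 : R -> R) y z :
  {within `[0, rhomax], continuous v1} -> {within `[0, rhomax], continuous v2} ->
  {in `[0, rhomax] &, {homo v1 : a b /~ a < b}} ->
  {in `[0, rhomax] &, {homo v2 : a b /~ a < b}} ->
  homogeneous_flow v1 v2 y z -> 0 < y 0 -> v2 (z 0) <= v1 (y 0) ->
  exists s w, [/\ 0 <= s <= 1 /\ 0 <= w <= 1, s + w = y 0 + z 0,
    source v1 v2 s w = 0,
    (y t @[t --> +oo] --> s) /\ (z t @[t --> +oo] --> w) &
    s = y 0 \/ y 0 <= s <= mu /\ v2 w <= v1 s].
Proof.
move=> c1 c2 dec1 dec2 flow y0_gt0 faster.
have [y01 z01 _ _ _] := flow 0 (lexx 0).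
have [/andP[_ y0_le1] /andP[z0_ge0 z0_le1]] := (y01, z01).
have at_rest s w : 0 <= s <= 1 -> 0 <= w <= 1 -> v2 w <= v1 s ->
    [\/ v1 s <= v2 w, mu <= s | w = 0] -> source v1 v2 s w = 0.
  move=> s01 w01 attracts blocks; apply/eqP; rewrite eq_le.
  case/andP: (s01) => s0 _; case/andP: (w01) => w0 _.
  by rewrite source_le0// source_ge0.
have [full|safe] := leP mu (y 0).
  exists (y 0), (z 0); split => //.
  - by apply: at_rest => //; apply: Or32.
  - apply: (@fills_up_to v1 v2) => //; first by rewrite lexx.
      exact: Or32.
    by left.
  - by left.
have y0_mu : 0 <= y 0 <= mu by rewrite !ltW.
have [s [w [swE y0s w0 attracts blocks]]] := fill_target c1 c2 y0_mu z01 faster.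
have [y0_s s_mu] := andP y0s.
have s01 : 0 <= s <= 1 by move: s_mu; rewrite /mu; lra.
have w01 : 0 <= w <= 1 by lra.
exists s, w; split => //.
- exact: at_rest.
- apply: (@fills_up_to v1 v2) => //; last by right.
  by case/andP: s01 => _ ->; rewrite y0_s.
- by right.
Qed.

(** Only the lane that is faster at time [0] can gain density, so exchanging the
lanes reduces this to [flow_settles_up].  The last clause records which lane was
filled, as this is what locates [s] later. *)
Lemma flow_settles (v1 v2 : R -> R) y z :
  {within `[0, rhomax], continuous v1} -> {within `[0, rhomax], continuous v2} ->
  {in `[0, rhomax] &, {homo v1 : a b /~ a < b}} ->
  {in `[0, rhomax] &, {homo v2 : a b /~ a < b}} ->
  homogeneous_flow v1 v2 y z -> 0 < y 0 -> 0 < z 0 ->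
  exists s w, [/\ 0 <= s <= 1 /\ 0 <= w <= 1, s + w = y 0 + z 0,
    source v1 v2 s w = 0,
    (y t @[t --> +oo] --> s) /\ (z t @[t --> +oo] --> w) &
    [\/ s = y 0, y 0 <= s <= mu /\ v2 w <= v1 s
      | z 0 <= w <= mu /\ v1 s <= v2 w]].
Proof.
move=> c1 c2 dec1 dec2 flow y0 z0.
have [faster|/ltW faster] := leP (v2 (z 0)) (v1 (y 0)).
  have [s [w [sw01 swE sw0 cvg_sw sE]]] :=
    flow_settles_up c1 c2 dec1 dec2 flow y0 faster.
  exists s, w; split => //.
  by case: sE => ?; [apply: Or31 | apply: Or32].
have [w [s [[w01 s01] wsE ws0 [cvg_w cvg_s] wE]]] :=
  flow_settles_up c2 c1 dec2 dec1 (flow_sym flow) z0 faster.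
have swE : s + w = y 0 + z 0 by rewrite addrC wsE addrC.
exists s, w; split => //; first by rewrite sourceN ws0 oppr0.
by case: wE => ?; [apply: Or31; lra | apply: Or33].
Qed.

End Flow.

(** * Locating the limit *)

Section Stability.
Context {R : realType}.

(** For [eps < 0] lane 1 starts below [r1] and fills up again, since [(r1, r2)]
is itself the first obstacle. *)
Lemma returns_filling1 (v1 v2 : R -> R) (L r1 r2 eps rho0 : R) :
  speed_functions v1 v2 -> admissible r1 r2 eps rho0 -> eps < 0 ->
  0 <= r2 -> r1 <= mu -> v2 r2 <= v1 r1 ->
  [\/ v1 r1 <= v2 r2, mu <= r1 | r2 = 0] -> returns v1 v2 L r1 r2 eps rho0.
Proof.
move=> [_ _ dec1 dec2 _] [_ rho0_gt0 /andP[y0 _] _] eps_lt0 r2_ge0 r1_mu.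
move=> attracts blocks rho pert; have flow := perturbed_flow pert.
have eps_rho0 : eps * rho0 < 0 by rewrite nmulr_rlt0.
have rho_0 : rho 0 = rho0 by case: pert.
apply: (fills_up_to dec1 dec2 flow) => //; rewrite ?rho_0//; last by right.
- by move: r1_mu; rewrite /mu; lra.
- by lra.
Qed.

Lemma returns_filling2 (v1 v2 : R -> R) (L r1 r2 eps rho0 : R) :
  speed_functions v1 v2 -> admissible r1 r2 eps rho0 -> 0 < eps ->
  0 <= r1 -> r2 <= mu -> v1 r1 <= v2 r2 ->
  [\/ v2 r2 <= v1 r1, mu <= r2 | r1 = 0] -> returns v1 v2 L r1 r2 eps rho0.
Proof.
move=> [_ _ dec1 dec2 _] [_ rho0_gt0 _ /andP[z0 _]] eps_gt0 r1_ge0 r2_mu.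
move=> attracts blocks rho pert; have flow := flow_sym (perturbed_flow pert).
have eps_rho0 : 0 < eps * rho0 by rewrite mulr_gt0.
have rho_0 : rho 0 = rho0 by case: pert.
apply/and_comm.
apply: (fills_up_to dec2 dec1 flow) => //; rewrite ?rho_0//; last by right.
- by move: r2_mu; rewrite /mu; lra.
- by lra.
Qed.

(** The two hypotheses confine the limits reached by filling lane 1 and by filling
lane 2.  Their strict inequalities make the limit different from [(r1, r2)], and
keep its lanes nonempty: the lane that loses density ends strictly above its
unperturbed density. *)
Lemma leaves_if (v1 v2 : R -> R) (L r1 r2 eps rho0 : R) :
  speed_functions v1 v2 -> admissible r1 r2 eps rho0 -> 0 <= r1 -> 0 <= r2 ->
  (forall s w, 0 <= s <= 1 -> 0 <= w <= 1 -> s + w = r1 + r2 ->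
     r1 + eps * rho0 <= s <= mu -> v2 w <= v1 s -> s < r1) ->
  (forall s w, s + w = r1 + r2 -> r2 - eps * rho0 <= w <= mu -> r1 < s) ->
  leaves v1 v2 L r1 r2 eps rho0.
Proof.
move=> [c1 c2 dec1 dec2 _] [eps0 rho0_gt0 /andP[y0 _] /andP[z0 _]].
move=> r1_ge0 r2_ge0 fill1 fill2 rho pert; have flow := perturbed_flow pert.
have rho_0 : rho 0 = rho0 by case: pert.
have := flow_settles c1 c2 dec1 dec2 flow; rewrite rho_0 => /(_ y0 z0).
move=> [s [w [[s01 w01] swE source0 cvg_sw sE]]].
have {}swE : s + w = r1 + r2 by lra.
have [s_gt0 w_gt0 s_r1] : [/\ 0 < s, 0 < w & s != r1].
  case: sE => [s_y0|[y0_s attracts]|[z0_w _]].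
  - split; [by rewrite s_y0|lra|].
    by rewrite s_y0 -subr_eq0 addrC addKr mulf_neq0// gt_eqF.
  - have s_r1 := fill1 _ _ s01 w01 swE y0_s attracts.
    by split; [lra|lra|rewrite lt_eqF].
  - have r1_s := fill2 _ _ swE z0_w.
    by split; [lra|lra|rewrite gt_eqF].
exists s, w; split => //; last by case=> /eqP; rewrite (negbTE s_r1).
by split => //; left.
Qed.

End Stability.

Theorem theorem4p3 (R : realType) (L : R) (v1 v2 : R -> R) (r1 r2 : R)
    (hL : 0 < L) (hv : speed_functions v1 v2)
    (hr : steady_state v1 v2 r1 r2) :
  [/\
      type_A v1 v2 r1 r2 \/ (type_E v1 v2 r1 r2 /\ r2 <= mu) ->
        globally_asymptotically_stable v1 v2 L r1 r2,
      (type_B2 v1 v2 r1 r2 \/ [/\ type_C r1 r2, r1 = mu & v2 r2 <= v1 r1] ->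
        asymptotically_stable_if (fun eps => eps < 0) v1 v2 L r1 r2) /\
      (type_B2 v1 v2 r1 r2 \/ (type_C r1 r2 /\ r1 = mu) -> r2 != mu ->
        marginally_stable_if (fun eps => 0 < eps) v1 v2 L r1 r2),
      (type_C r1 r2 \/ type_D v1 v2 r1 r2) -> r2 = mu ->
        asymptotically_stable_if (fun eps => 0 < eps) v1 v2 L r1 r2 /\
        marginally_stable_if (fun eps => eps < 0) v1 v2 L r1 r2 &
      (type_C r1 r2 /\ mu < r1 /\ mu < r2) \/
      (type_D v1 v2 r1 r2 /\ mu < r2) ->
        marginally_stable v1 v2 L r1 r2].
Proof.
have [_ _ dec1 dec2 [v12 _]] := hv.
have [] := hr; rewrite /rhomax => /andP[r1_ge0 r1_le1] /andP[r2_ge0 r2_le1] _ _.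
have mu_gt0 : (0 : R) < mu by rewrite /mu; lra.
have mu_le1 : (mu : R) <= 1 by rewrite /mu; lra.
have v12_mu : v1 mu < v2 mu by apply: v12; rewrite in_itv/= /rhomax /mu; lra.
have slower_mu r : mu <= r -> r <= 1 -> v1 r < v2 mu.
  move=> r_mu r1'; apply: le_lt_trans v12_mu.
  by apply: antitone_le dec1 _ _; rewrite ?(ltW mu_gt0).
have B2_lt : type_B2 v1 v2 r1 r2 -> r1 < mu <= r2.
  move=> [_ dense /andP[v1_mu _]].
  have r1_mu : r1 < mu.
    rewrite ltNge; apply/negP => r1_mu; move: v1_mu; apply/negP; rewrite -leNgt.
    by apply: antitone_le dec1 _ _; rewrite ?(ltW mu_gt0).
  by rewrite r1_mu; case: dense; rewrite ?leNgt ?r1_mu.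
(* where lane 1 is slower at r1, the speeds balance strictly below r1 *)
have fills_below s w : v1 r1 < v2 r2 -> 0 <= s <= 1 -> 0 <= w <= 1 ->
    s + w = r1 + r2 -> v2 w <= v1 s -> s < r1.
  move=> gap /andP[s0 s1] /andP[w0 w1] swE; apply: contraTT.
  rewrite -!leNgt -ltNge => r1_s.
  apply: le_lt_trans (lt_le_trans gap _).
    by apply: antitone_le dec1 _ _; rewrite ?r1_ge0.
  by apply: antitone_le dec2 _ _ => //; rewrite w0; lra.
split.
- case=> [[vE /andP[_ r1_mu] /andP[_ r2_mu]] eps rho0 adm
          |[[r10 [r [/andP[_ r_le1] vr r2_r]]] r2_mu] eps rho0 adm].
  + have [eps0|eps0|eps0] := ltgtP eps 0.
    * apply: returns_filling1; rewrite ?vE// ?(ltW r1_mu)//; exact: Or31.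
    * apply: returns_filling2; rewrite ?vE// ?(ltW r2_mu)//; exact: Or31.
    * by case: adm; rewrite eps0 eqxx.
  + have eps0 : 0 < eps.
      by case: adm => _ rho0_gt0 /andP[+ _] _; rewrite r10 add0r pmulr_lgt0.
    apply: returns_filling2 => //; last exact: Or33.
    rewrite r10 -vr; apply: antitone_le dec2 _ _ => //; exact/andP.
- split.
  + move=> hBC eps rho0 adm eps0; case: hBC => [B2|[_ r1_mu slower]].
      have /andP[r1_mu _] := B2_lt B2; have [vE _ _] := B2.
      apply: returns_filling1; rewrite ?vE// ?(ltW r1_mu)//; exact: Or31.
    by apply: returns_filling1; rewrite // r1_mu//; apply: Or32.
  + move=> hBC r2_neq eps rho0 adm eps0.
    have eps_rho0 : 0 < eps * rho0 by rewrite mulr_gt0//; case: adm.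
    have mu_r2 : mu < r2.
      rewrite lt_neqAle eq_sym r2_neq; case: hBC => [/B2_lt/andP[]//|[[]//]].
    apply: leaves_if => // [s w|s w swE]; last lra.
    move=> /andP[s0 s1] /andP[w0 w1] swE /andP[y0_s s_mu] attracts.
    exfalso; case: hBC => [[vE _ _]|[_ r1_mu]]; last lra.
    move: attracts; apply/negP; rewrite -ltNge.
    apply: (@lt_trans _ _ (v1 r1)); last rewrite vE.
      by apply: dec1; rewrite ?in_itv/= /rhomax; lra.
    by apply: dec2; rewrite ?in_itv/= /rhomax; lra.
- move=> hCD r2_mu.
  have gap : v1 r1 < v2 r2.
    by case: hCD => [[r1_mu _]|[]//]; rewrite r2_mu slower_mu.
  split=> eps rho0 adm eps0.
    apply: returns_filling2 => //; [by rewrite r2_mu | exact: ltW |].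
    by apply: Or32; rewrite r2_mu.
  have eps_rho0 : eps * rho0 < 0 by rewrite nmulr_rlt0//; case: adm.
  apply: leaves_if => // [s w s01 w01 swE _|s w swE]; first exact: fills_below.
  lra.
- move=> hCD eps rho0 adm.
  have mu_r2 : mu < r2 by case: hCD => [[_ []]|[]].
  apply: leaves_if => // [s w s01 w01 swE|s w swE]; last lra.
  move=> /andP[_ s_mu] attracts.
  case: hCD => [[_ [r1_mu _]]|[[gap _ _] _]]; first exact: le_lt_trans r1_mu.
  exact: fills_below attracts.
Qed.
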